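(* Let $\langle N,M_0\rangle$ be a marked net with $m$ places and a basis partition $\pi=(T_E,T_I)$, let $\mathcal{M}_{B_M}$ be its set of minimax basis markings, and let $M\in\mathbb{N}^m$. Then $M\in R(N,M_0)$ if and only if there exists a minimax basis marking $M_b\in\mathcal{M}_{B_M}$ such that $M\in R_I(M_b)$.
   Context: **Petri nets.** A Petri net is $N=(P,T,Pre,Post)$ with a finite set $P$ of $m$ places, a finite set $T$ of transitions, and functions $Pre,Post:P\times T\to\mathbb{N}$ ($\mathbb{N}=\{0,1,2,\dots\}$); $C=Post-Pre$, and $A(\cdot,t)$ is the column of a matrix $A$ at $t$. A marking is a vector $M\in\mathbb{N}^m$. Transition $t$ is enabled at $M$ if $M\ge Pre(\cdot,t)$ componentwise, and its firing yields $M'=M+C(\cdot,t)$, written $M[t\rangle M'$. This extends to finite sequences $\sigma\in T^*$ (with $M[\varepsilon\rangle M$ for the empty sequence): $M[\sigma\rangle M'$. $R(N,M)$ is the set of markings reachable from $M$. A marked net is a pair $\langle N,M_0\rangle$ with initial marking $M_0$. **Basis partitions.** A basis partition is a pair $\pi=(T_E,T_I)$ with $T=T_E\cup T_I$ disjoint (explicit and implicit transitions) such that the $T_I$-induced sub-net (same places, only the transitions in $T_I$, with $Pre,Post$ restricted) has no directed cycle in its underlying digraph (arcs $p\to t$ when $Pre(p,t)>0$, $t\to p$ when $Post(p,t)>0$). Let $n_I=|T_I|$ and let $C_I$ be the incidence matrix of this sub-net. For $\sigma\in T_I^*$, $\varphi(\sigma)\in\mathbb{N}^{n_I}$ is the vector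 counting occurrences of each transition in $\sigma$. **Explanations.** For a marking $M$ and $t\in T_E$: $\Sigma(M,t)=\{\sigma\in T_I^*\mid M[\sigma\rangle M',\ M'\ge Pre(\cdot,t)\}$; $\Sigma_{\min}(M,t)$ (resp. $\Sigma_{\max}(M,t)$) is the set of $\sigma\in\Sigma(M,t)$ for which there is no $\sigma'\in\Sigma(M,t)$ with $\varphi(\sigma')\le\varphi(\sigma)$ (resp. $\ge$) componentwise and $\varphi(\sigma')\neq\varphi(\sigma)$; $Y_{\min}(M,t)=\varphi(\Sigma_{\min}(M,t))$, $Y_{\max}(M,t)=\varphi(\Sigma_{\max}(M,t))$. **Minimax basis markings.** The set $\mathcal{M}_{B_M}$ of minimax basis markings is the smallest set such that $M_0\in\mathcal{M}_{B_M}$, and whenever $M\in\mathcal{M}_{B_M}$, $t\in T_E$ and $\mathbf{y}\in Y_{\min}(M,t)\cup Y_{\max}(M,t)$, then $M+C_I\mathbf{y}+C(\cdot,t)\in\mathcal{M}_{B_M}$. **Implicit reach.** $R_I(M_b)=\{M\in\mathbb{N}^m\mid \exists\sigma\in T_I^*:\ M_b[\sigma\rangle M\}$. *)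

(* Defs.v *)
From HB Require Import structures.
From mathcomp Require Import all_boot all_order all_algebra.

Set Implicit Arguments.
Unset Strict Implicit.
Unset Printing Implicit Defensive.

Import GRing.Theory.
Local Open Scope ring_scope.

Record petri_net := PetriNet {
  place : finType;
  trans : finType;
  pre : place -> trans -> nat;
  post : place -> trans -> nat
}.

(* Vectors of naturals are indexed directly by the finite set in question
   (places, transitions) rather than by an enumeration of it. *)
Definition natvec (X : finType) := {ffun X -> nat}.

Definition marking (N : petri_net) := natvec (place N).

Definition zvec (X : finType) (v : natvec X) : {ffun X -> int} :=
  [ffun x => (v x)%:Z].

Definition vle (X : finType) (v w : natvec X) : Prop :=
  forall x, (v x <= w x)%N.

Definition incidence (N : petri_net) (p : place N) (t : trans N) : int :=
  (post p t)%:Z - (pre p t)%:Z.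

Definition incidence_col (N : petri_net) (t : trans N) :
    {ffun place N -> int} :=
  [ffun p => incidence p t].

Definition incidence_mul (N : petri_net) (y : natvec (trans N)) :
    {ffun place N -> int} :=
  [ffun p => \sum_(t : trans N) incidence p t * (y t)%:Z].

Definition pre_col (N : petri_net) (t : trans N) : marking N :=
  [ffun p => pre p t].

Definition enabled (N : petri_net) (M : marking N) (t : trans N) : Prop :=
  vle (pre_col t) M.

Definition fires (N : petri_net) (M : marking N) (t : trans N)
    (M' : marking N) : Prop :=
  enabled M t /\ zvec M' = zvec M + incidence_col t.

Fixpoint fires_seq (N : petri_net) (M : marking N) (s : seq (trans N))
    (M' : marking N) : Prop :=
  if s is t :: s' then exists M1, fires M t M1 /\ fires_seq M1 s' M'
  else M' = M.

Definition reachable (N : petri_net) (M M' : marking N) : Prop :=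
  exists s : seq (trans N), fires_seq M s M'.

Definition net_arc (N : petri_net) : rel (place N + trans N) := fun u v =>
  match u, v with
  | inl p, inr t => (0 < pre p t)%N
  | inr t, inl p => (0 < post p t)%N
  | _, _ => false
  end.

Definition acyclic_net (N : petri_net) : Prop :=
  forall c : seq (place N + trans N), ucycle (@net_arc N) c -> c = [::].

Definition induced (N : petri_net) (TI : {set trans N}) : petri_net :=
  @PetriNet (place N) {t : trans N | t \in TI}
    (fun p t => pre p (val t)) (fun p t => post p (val t)).

Definition basis_partition (N : petri_net) (TE TI : {set trans N}) : Prop :=
  [/\ TE :|: TI = [set: trans N], [disjoint TE & TI]
    & acyclic_net (induced TI)].

(* Elements of T_I^* are sequences of transitions of the induced sub-net;
   they are read as sequences of the whole net through [val]. *)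
Definition fires_imp (N : petri_net) (TI : {set trans N}) (M : marking N)
    (s : seq (trans (induced TI))) (M' : marking N) : Prop :=
  fires_seq M [seq val t | t <- s] M'.

Definition parikh (T : finType) (s : seq T) : natvec T :=
  [ffun t => count_mem t s].

Section Explanations.
Variables (N : petri_net) (TI : {set trans N}).
Implicit Types (M : marking N) (t : trans N) (s : seq (trans (induced TI))).

Definition explanation M t s : Prop :=
  exists M', fires_imp M s M' /\ vle (pre_col t) M'.

Definition min_explanation M t s : Prop :=
  explanation M t s /\
  ~ exists s', [/\ explanation M t s', vle (parikh s') (parikh s)
                 & parikh s' <> parikh s].

Definition max_explanation M t s : Prop :=
  explanation M t s /\
  ~ exists s', [/\ explanation M t s', vle (parikh s) (parikh s')
                 & parikh s' <> parikh s].

Definition Ymin M t (y : natvec (trans (induced TI))) : Prop :=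
  exists s, min_explanation M t s /\ parikh s = y.

Definition Ymax M t (y : natvec (trans (induced TI))) : Prop :=
  exists s, max_explanation M t s /\ parikh s = y.

Definition implicit_reach M M' : Prop :=
  exists s, fires_imp M s M'.

End Explanations.

(* The next marking is given by an equation over the integers; its right-hand
   side is always nonnegative, as y is the firing vector of a sequence firable
   at M after which t is enabled. *)
Inductive minimax_basis_marking (N : petri_net) (M0 : marking N)
    (TE TI : {set trans N}) : marking N -> Prop :=
| minimax_init : minimax_basis_marking M0 TE TI M0
| minimax_step (M M' : marking N) (t : trans N)
    (y : natvec (trans (induced TI))) :
    minimax_basis_marking M0 TE TI M ->
    t \in TE ->
    Ymin M t y \/ Ymax M t y ->
    zvec M' = zvec M + incidence_mul y + incidence_col t ->
    minimax_basis_marking M0 TE TI M'.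

(* Main.v *)
Require Import Defs.
From mathcomp Require Import all_boot all_order all_algebra.
From mathcomp Require Import zify.
From Stdlib Require Import Classical_Prop.

(** A firable sequence of T_I is rearranged using that, in an acyclic net, the
    state equation is sufficient for firability: if M and M + C y are both
    nonnegative, then some sequence with firing vector y is firable at M.
    Given M_b [s1> M1 [t> M with s1 over T_I and t explicit, replace s1 by a
    minimal explanation s' below it and postpone the remaining transitions,
    phi(s1) - phi(s'), after t: the marking reached by s' t is a basis marking,
    and M is implicitly reachable from it by the state equation. Only minimal
    explanations are needed for completeness; the maximal ones only have to be
    sound. *)

Set Implicit Arguments.
Unset Strict Implicit.
Unset Printing Implicit Defensive.

Import GRing.Theory Num.Theory.
Local Open Scope ring_scope.

(** Walking backwards inside [A] along chosen predecessors must revisit a vertex, as [V] is finite;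
    this closes a cycle. *)
Lemma ucycle_of_closed_predecessors (V : finType) (e : rel V) (A : pred V)
    (x : V) :
  A x -> (forall u, A u -> exists2 v, A v & e v u) ->
  exists2 c, c <> [::] & ucycle e c.
Proof.
move=> Ax Apred; pose f u := odflt u [pick v | A v && e v u].
have fP u : A u -> A (f u) /\ e (f u) u.
  rewrite /f => /Apred[v Av evu]; case: pickP => [w /andP[]//|/(_ v)].
  by rewrite Av evu.
have Aiter n u : A u -> A (iter n f u) by elim: n => //= n IH /IH /fP[].
have /trajectP[i lt_i eq_i] := looping_order f x.
set u := iter i f x in eq_i.
have u_loop : iter (order f x - i) f u = u.
  by rewrite /u -iterD subnK 1?ltnW.
have cycu : fcycle f (orbit f u).
  (* The criterion asks for a return after [n.+1] steps, hence the predecessor; [lt_i] makes the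
     number of steps positive. *)
  apply/(orbitPcycle 0 3); exists (order f x - i).-1.
  by rewrite prednK ?subn_gt0.
(* [f] runs against the arcs, so its orbit lists the cycle backwards. *)
exists (rev (orbit f u)).
  move/(congr1 size)/eqP; rewrite size_rev size_orbit.
  by rewrite -[_ == _]negbK -lt0n order_gt0.
rewrite /ucycle rev_cycle rev_uniq orbit_uniq andbT.
have : {in [in orbit f u] &, subrel (frel f) (fun y z => e z y)}.
  move=> y z y_in _ /= /eqP <-; move/trajectP: y_in => [n _ ->].
  by have [] := fP _ (Aiter n _ (Aiter i _ Ax)).
move=> sub; apply: (sub_in_cycle sub) cycu; exact/allP.
Qed.

Lemma zvec_inj (X : finType) : injective (@zvec X).
Proof.
move=> v w /ffunP eq_vw; apply/ffunP => x; have := eq_vw x.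
by rewrite !ffunE => -[].
Qed.

Section Firing.
Variable N : petri_net.
Implicit Types (M : marking N) (t : trans N) (s : seq (trans N)).
Implicit Types y z : natvec (trans N).

Lemma incidence_mulD y z :
  incidence_mul [ffun t => (y t + z t)%N] = incidence_mul y + incidence_mul z.
Proof.
apply/ffunP => p; rewrite !ffunE -big_split; apply: eq_bigr => t _.
by rewrite ffunE PoszD mulrDr.
Qed.

Lemma incidence_mul1 t :
  incidence_mul [ffun u => nat_of_bool (t == u)] = incidence_col t.
Proof.
apply/ffunP => p; rewrite !ffunE (bigD1 t) //= ffunE eqxx mulr1 big1 ?addr0 //.
by move=> u /negPf neq_ut; rewrite ffunE eq_sym neq_ut mulr0.
Qed.

Lemma parikh_cons t s :
  parikh (t :: s) = [ffun u => ((t == u) + parikh s u)%N].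
Proof. by apply/ffunP => u; rewrite !ffunE. Qed.

Lemma incidence_mul_parikh_nil :
  incidence_mul (parikh [::] : natvec (trans N)) = 0.
Proof.
by apply/ffunP => p; rewrite !ffunE big1 // => t _; rewrite ffunE mulr0.
Qed.

Lemma incidence_mul_parikh_cons t s :
  incidence_mul (parikh (t :: s)) = incidence_col t + incidence_mul (parikh s).
Proof.
rewrite -incidence_mul1 -incidence_mulD; congr incidence_mul.
by apply/ffunP => u; rewrite !ffunE.
Qed.

Lemma fires_seq_cat M s1 s2 M' :
  fires_seq M (s1 ++ s2) M' <->
  exists M1, fires_seq M s1 M1 /\ fires_seq M1 s2 M'.
Proof.
elim: s1 M => [|t s1 IH] M /=; first by split=> [|[_ [->]]//]; exists M.
split=> [[M1 [fire_t /IH[M2 [? ?]]]]|[M2 [[M1 [? ?]] ?]]].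
  by exists M2; split=> //; exists M1.
by exists M1; split=> //; apply/IH; exists M2.
Qed.

Lemma state_equation M s M' :
  fires_seq M s M' -> zvec M' = zvec M + incidence_mul (parikh s).
Proof.
elim: s M => [|t s IH] M /=.
  by move->; rewrite incidence_mul_parikh_nil addr0.
by case=> M1 [[_ eqM1] /IH->]; rewrite eqM1 incidence_mul_parikh_cons addrA.
Qed.

Lemma enabled_fires M t : enabled M t -> exists M', fires M t M'.
Proof.
move=> en_t; exists [ffun p => (M p - pre p t + post p t)%N]; split=> //.
apply/ffunP => p; have := en_t p; rewrite !ffunE /incidence; lia.
Qed.

(** Otherwise each transition in the support of [y] has an input place short of tokens, and each
    such place is fed by a transition of the support: going back forever yields a cycle. *)
Lemma acyclic_enabled M M' y t :
  acyclic_net N -> zvec M' = zvec M + incidence_mul y -> (0 < y t)%N ->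
  exists2 u, enabled M u & (0 < y u)%N.
Proof.
move=> acN eqM' yt_gt0; apply: NNPP => dead.
have blocked u : (0 < y u)%N -> exists p, (M p < pre p u)%N.
  move=> yu_gt0; apply: NNPP => no_p; case: dead; exists u => // p.
  by rewrite ffunE leqNgt; apply/negP => lt_p; case: no_p; exists p.
pose short p := [exists u, (0 < y u)%N && (M p < pre p u)%N].
(* A place short of tokens must receive some from the support of [y], since
   its token count after [y] is nonnegative. *)
have fed p : short p -> exists2 u, (0 < y u)%N & (0 < post p u)%N.
  case/existsP=> u /andP[yu_gt0 lt_pu]; apply: NNPP => no_feed.
  have post0 v : (0 < y v)%N -> post p v = 0%N.
    move=> yv_gt0; apply/eqP; rewrite -leqn0 leqNgt.
    by apply/negP => ?; case: no_feed; exists v.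
  have C_le0 v : incidence p v * (y v)%:Z <= 0.
    have [->|/post0 post_pv] := posnP (y v); first by rewrite mulr0.
    rewrite /incidence post_pv; nia.
  (* With nothing feeding [p], [u] alone removes at least [pre p u > M p] tokens, which would make
     [M' p] negative. *)
  have Cu_le : incidence p u * (y u)%:Z <= - (pre p u)%:Z.
    rewrite /incidence post0 // sub0r mulNr lerN2 -PoszM lez_nat.
    exact: leq_pmulr.
  have /ffunP/(_ p) := eqM'; rewrite !ffunE (bigD1 u) //=.
  set S := (X in _ + (_ + X)); have S_le0 : S <= 0 by apply: sumr_le0.
  move: (incidence p u * _) S Cu_le S_le0 => c S; lia.
pose A (v : place N + trans N) :=
  match v with inl p => short p | inr u => (0 < y u)%N end.
have [//|[p /fed[u yu_gt0 ?]|u yu_gt0]|c c_nnil /acN//] :=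
  @ucycle_of_closed_predecessors _ (@net_arc N) A (inr t).
- by exists (inr u).
- have [p lt_pu] := blocked u yu_gt0; exists (inl p).
    by apply/existsP; exists u; apply/andP.
  exact: leq_ltn_trans lt_pu.
Qed.

(** Induction on the total of [y]: fire an enabled transition of the support and subtract it from
    [y]; the state equation towards [M'] persists. *)
Lemma acyclic_firable M M' y :
  acyclic_net N -> zvec M' = zvec M + incidence_mul y ->
  exists2 s, fires_seq M s M' & parikh s = y.
Proof.
move=> acN; have [n] := ubnP (\sum_t y t)%N; elim: n => // n IH in M y *.
move=> lt_yn eqM'; case: (pickP (fun t => 0 < y t)%N) => [t0 yt0_gt0|y0].
  have [t en_t yt_gt0] := acyclic_enabled acN eqM' yt0_gt0.
  have [M1 fire_t] := enabled_fires en_t.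
  pose z : natvec (trans N) := [ffun u => (y u - (t == u))%N].
  have yE : y = [ffun u => ([ffun u => nat_of_bool (t == u)] u + z u)%N].
    by apply/ffunP => u; rewrite !ffunE; case: eqVneq => [<-|_] /=; lia.
  have lt_zn : (\sum_u z u < n)%N.
    move: lt_yn; rewrite (bigD1 t) //= [in X in X -> _](eq_bigr z); last first.
      by move=> u /negPf neq_ut; rewrite ffunE eq_sym neq_ut subn0.
    rewrite [X in _ -> (X < _)%N](bigD1 t) //= [z t]ffunE eqxx; lia.
  have [|s fire_s parikh_s] := IH M1 z lt_zn.
    by rewrite eqM' yE incidence_mulD incidence_mul1 fire_t.2 addrA.
  exists (t :: s); first by exists M1.
  by rewrite parikh_cons parikh_s yE; apply/ffunP => u; rewrite !ffunE.
have yE : y = parikh [::].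
  by apply/ffunP => t; have := y0 t; rewrite ffunE /=; case: (y t).
exists [::] => //=; apply: zvec_inj.
by rewrite eqM' yE incidence_mul_parikh_nil addr0.
Qed.

End Firing.

(** Lets the results on acyclic nets be applied to [induced TI], whose markings are those of [N]. *)
Lemma fires_impE (N : petri_net) (TI : {set trans N}) (M M' : marking N)
    (s : seq (trans (induced TI))) :
  fires_imp M s M' <-> fires_seq (N := induced TI) M s M'.
Proof.
rewrite /fires_imp; elim: s M => [|t s IH] M //=.
by split=> -[M1 [fire_t /IH fire_s]]; exists M1.
Qed.

Lemma sum_parikh (T : finType) (s : seq T) : (\sum_t parikh s t = size s)%N.
Proof.
rewrite -sum1_size; under eq_bigr do rewrite ffunE -sum1_count.
rewrite (exchange_big_dep predT) //=.
apply: eq_bigr => x _; rewrite sum1_card -[RHS](card1 x).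
by apply: eq_card => u; rewrite !inE eq_sym.
Qed.

(** Length is the sum of the firing vector, so it serves as the measure for the descent to a minimal
    explanation. *)
Lemma parikh_lt_size (T : finType) (s' s : seq T) :
  vle (parikh s') (parikh s) -> parikh s' <> parikh s -> (size s' < size s)%N.
Proof.
move=> le_s's neq_s's; rewrite -!sum_parikh ltn_neqAle leq_sum ?andbT //.
apply/eqP => eq_sum; apply: neq_s's; apply/ffunP => t.
(* Equality case: equal sums of termwise comparable families force equal terms. *)
have [_] := leqif_sum (fun u (_ : predT u) => leqif_eq (le_s's u)).
by rewrite eq_sum eqxx => /esym/forallP/(_ t)/eqP.
Qed.

Lemma min_explanation_below (N : petri_net) (TI : {set trans N})
    (M : marking N) (t : trans N) (s : seq (trans (induced TI))) :
  explanation M t s ->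
  exists2 s', min_explanation M t s' & vle (parikh s') (parikh s).
Proof.
have [n] := ubnP (size s); elim: n => // n IH in s * => lt_sn expl_s.
have [[s1 [expl_s1 le_s1s neq_s1s]]|min_s] := classic (exists s',
  [/\ explanation M t s', vle (parikh s') (parikh s) & parikh s' <> parikh s]).
  have [|s' min_s' le_s's1] := IH s1 _ expl_s1.
    exact: leq_trans (parikh_lt_size le_s1s neq_s1s) _.
  by exists s' => // u; apply: leq_trans (le_s's1 u) (le_s1s u).
by exists s.
Qed.

Section Basis.
Variables (N : petri_net) (M0 : marking N) (TE TI : {set trans N}).
Implicit Types (M : marking N) (t : trans N) (s : seq (trans (induced TI))).

Lemma fires_imp_state_equation M s M' :
  fires_imp M s M' -> zvec M' = zvec M + incidence_mul (parikh s).
Proof. by move/fires_impE/state_equation. Qed.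

(** Minimal or maximal, [y] counts a firable explanation [s]; firing [s] and then [t] realizes the
    step. *)
Lemma minimax_basis_marking_reachable M :
  minimax_basis_marking M0 TE TI M -> reachable M0 M.
Proof.
elim=> [|{}M M' t y _ [s0 fire_s0] _ Yy eqM']; first by exists [::].
have [s [M1 [fire_s en_t]] eqy] : exists2 s, explanation M t s & parikh s = y.
  by case: Yy => -[s [[expl_s _] eqy]]; exists s.
exists (s0 ++ map val s ++ [:: t]); apply/fires_seq_cat; exists M; split=> //.
apply/fires_seq_cat; exists M1; split=> //=; exists M'; split=> //; split=> //.
by rewrite eqM' -eqy (fires_imp_state_equation fire_s).
Qed.

Hypothesis TI_acyclic : acyclic_net (induced TI).

Lemma postpone_implicit Mb M1 M t :
  minimax_basis_marking M0 TE TI Mb -> implicit_reach TI Mb M1 ->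
  t \in TE -> fires M1 t M ->
  exists2 Mb', minimax_basis_marking M0 TE TI Mb' & implicit_reach TI Mb' M.
Proof.
move=> basis_Mb [s fire_s] tTE [en_t eqM].
have expl_s : explanation Mb t s by exists M1.
have [s' min_s' le_s's] := min_explanation_below expl_s.
have [[M2 [fire_s' en2_t]] _] := min_s'.
have [Mb' [_ eqMb']] := enabled_fires en2_t.
exists Mb'.
  apply: (minimax_step (t := t) (y := parikh s') basis_Mb tTE).
    by left; exists s'.
  by rewrite eqMb' (fires_imp_state_equation fire_s').
(* The implicit firings postponed until after [t]; the truncated subtraction is exact by
   [le_s's]. *)
pose y : natvec (trans (induced TI)) :=
  [ffun u => (parikh s u - parikh s' u)%N].
have eq_s : parikh s = [ffun u => (parikh s' u + y u)%N].
  apply/ffunP => u; rewrite !ffunE subnKC //.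
  by have := le_s's u; rewrite !ffunE.
have [|s2 fire_s2 _] :=
  @acyclic_firable (induced TI) Mb' M y TI_acyclic; last first.
  by exists s2; apply/fires_impE.
rewrite eqM eqMb' (fires_imp_state_equation fire_s) eq_s incidence_mulD.
rewrite (fires_imp_state_equation fire_s') !addrA [LHS]addrAC.
reflexivity.
Qed.

End Basis.

Theorem proposition2 (N : petri_net) (M0 : marking N)
    (TE TI : {set trans N}) (Hpi : basis_partition TE TI) (M : marking N) :
  reachable M0 M <->
  exists Mb : marking N,
    minimax_basis_marking M0 TE TI Mb /\ implicit_reach TI Mb M.
Proof.
have [eqT _ acI] := Hpi; split=> [[s]|[Mb [basis_Mb [s fire_s]]]]; last first.
  have [s0 fire_s0] := minimax_basis_marking_reachable basis_Mb.
  by exists (s0 ++ map val s); apply/fires_seq_cat; exists Mb.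
(* Induction on the last transition: an explicit one changes the basis marking, an implicit one
   extends the implicit sequence. *)
elim/last_ind: s M => [|s t IH] M.
  by move=> /= ->; exists M0; split; [exact: minimax_init | exists [::]].
rewrite -cats1 => /fires_seq_cat[M1 [/IH[Mb [basis_Mb reach_M1]]]].
move=> /= [M2 [fire_t ->]].
have : t \in TE :|: TI by rewrite eqT inE.
rewrite inE => /orP[tTE|tTI].
  have [Mb' ? ?] := postpone_implicit acI basis_Mb reach_M1 tTE fire_t.
  by exists Mb'.
exists Mb; split=> //; have [s1 fire_s1] := reach_M1.
exists (s1 ++ [:: Sub t tTI]); rewrite /fires_imp map_cat.
by apply/fires_seq_cat; exists M1; split=> //=; exists M2.
Qed.
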